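(* Let $d\ge 1$, $n\in\{1,2,\dots\}\cup\{\infty\}$, and let $\{\xi(i,m)\}$, $1\le i\le n$ ($i$ finite), $m=1,\dots,d$, be centered martingale differences relative to one common filtration $\{F(i)\}$. Put $\nu_m(p)=\sup_{i}|\xi(i,m)|_p$ and assume that, for each $m=1,\dots,d$, $\nu_m\in G(\nu,r_m)$ for some $2<r_m<\infty$. Define recursively, for $p\ge 2$, $$\zeta_1(p)=K_M(p)\,\nu_1(p),\qquad \zeta_{m+1}(p)=K_M(p)\cdot(\zeta_m\otimes\nu_{m+1})(p),\quad m=1,\dots,d-1 .$$ Let $r=\left(\sum_{m=1}^d 1/r_m\right)^{-1}$ and suppose $r>1$. Then $$\sup_{b\in B(d,n)}\|Q(d,n,b)\|G(\zeta_d)\ \le\ \prod_{m=1}^d\|\vec\xi(m)\|G(\nu_m,r_m),$$ where $\|Q\|G(\zeta_d)=\sup_{p\in(2,r)}|Q|_p/\zeta_d(p)$ and $\|\vec\xi(m)\|G(\nu_m,r_m)=\sup_{p\in(2,r_m)}\sup_i|\xi(i,m)|_p/\nu_m(p)$.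
   Context: All random variables live on a probability space $(\Omega,F,\mathbf P)$; $|\xi|_p=(\mathbf E|\xi|^p)^{1/p}$. Suprema of nonnegative quantities over the empty set are $0$. Martingale differences: $F(0)=\{\emptyset,\Omega\}$, $F(i)\subset F(i+1)\subset F$; each $\xi(i,m)$ is $F(i)$-measurable, $\mathbf E\xi(i,m)=0$, and $\mathbf E[\xi(i,m)\mid F(k)]=0$ a.s. for all $k=0,1,\dots,i-1$. The filtration is the same for all $m=1,\dots,d$. The vectors $\vec\xi(m)=\{\xi(i,m)\}_i$ for different $m$ may be dependent or even coincide. Polynomial: $I(d,n)=\{(i_1,\dots,i_d):1\le i_1<i_2<\dots<i_d\le n\}$ (finite indices); for a real non-random array $b=(b(I))_{I\in I(d,n)}$, $$Q(d,n,b)=\sum_{I=(i_1,\dots,i_d)\in I(d,n)}b(I)\prod_{m=1}^d\xi(i_m,m).$$ For $n=\infty$, $Q(d,\infty,b)=\lim_{n\to\infty}Q(d,n,b)$, for those $b$ for which this limit exists with probability one. $B(d,n)=\{b:\sum_{I\in I(d,n)}b^2(I)=1\}$. Class $G(\nu,r)$ ($r>2$): functions $\nu$ that are continuous, positive and finite on $[1,r)$, with $\inf_{p\in(2,r)}\nu(p)>0$ and $\nu(p)=\infty$ for $p>r$. Operation $\otimes$: $(\nu_1\otimes\nu_2)(p)=\inf\{\nu_1(p/a)\,\nu_2(p/b):a,b>0,\ a+b=1\}$, for functions with values in $(0,\infty]$. Constant $K_M(p)$, $p\ge2$: the smallest constant $K$ such that for every finite $n$, every sequence $\theta(1),\dots,\theta(n)$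 of centered martingale differences relative to some filtration, and all real $b(1),\dots,b(n)$ with $\sum_i b^2(i)=1$, one has $\left|\sum_{i=1}^n b(i)\theta(i)\right|_p\le K\sup_i|\theta(i)|_p$. (It is known that $K_M(p)\le p\sqrt2$.) *)

(* Defs.v *)
From HB Require Import structures.
From mathcomp Require Import all_boot all_order all_algebra.
From mathcomp Require Import all_classical all_reals all_analysis.

Set Implicit Arguments.
Unset Strict Implicit.
Unset Printing Implicit Defensive.

Import Order.TTheory GRing.Theory Num.Theory.
Import numFieldNormedType.Exports.

Local Open Scope classical_set_scope.
Local Open Scope ring_scope.

(* Supremum of a set of nonnegative extended reals, equal to 0 (and not -oo)
   on the empty set. *)
Definition nnsup (R : realType) (A : set (\bar R)) : \bar R :=
  ereal_sup (0%E |` A).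

(* |X|_p = (E |X|^p)^(1/p) for a real exponent p *)
Definition pnorm (R : realType) (disp : measure_display)
    (T : measurableType disp) (P : probability T R) (p : R) (X : T -> R)
    : \bar R :=
  'N[P]_(p%:E)[EFin \o X]%E.

Definition measurable_wrt (R : realType) (T : Type) (G : set (set T))
    (X : T -> R) : Prop :=
  forall B : set R, measurable B -> G (X @^-1` B).

(* Y is a version of the conditional expectation E[X | G]. *)
Definition is_cond_expectation (R : realType) (disp : measure_display)
    (T : measurableType disp) (P : probability T R) (G : set (set T))
    (X Y : T -> R) : Prop :=
  [/\ P.-integrable setT (EFin \o X),
      P.-integrable setT (EFin \o Y),
      measurable_wrt G Y &
      forall A, G A ->
        (\int[P]_(w in A) (Y w)%:E = \int[P]_(w in A) (X w)%:E)%E].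

Definition is_filtration (disp : measure_display) (T : measurableType disp)
    (F : nat -> set (set T)) : Prop :=
  [/\ F 0%N = [set set0; setT],
      forall i, sigma_algebra setT (F i),
      forall i, F i `<=` F i.+1 &
      forall i, F i `<=` measurable].

(* A number n of terms in {1, 2, ...} \cup {oo} is an [option nat], with
   [None] standing for oo. The indices themselves are finite and start at 1. *)
Definition index_range (n : option nat) : set nat :=
  [set i | (0 < i)%N /\ (if n is Some N then (i <= N)%N else true)].

(* "E[xi i | F k] = 0 a.s." is expressed by: the constant 0 is a version of
   the conditional expectation. *)
Definition martingale_differences (R : realType) (disp : measure_display)
    (T : measurableType disp) (P : probability T R) (F : nat -> set (set T))
    (n : option nat) (xi : nat -> T -> R) : Prop :=
  forall i, index_range n i ->
    [/\ measurable_wrt (F i) (xi i),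
        P.-integrable setT (EFin \o xi i),
        ('E_P[xi i] = 0)%E &
        forall k, (k < i)%N -> is_cond_expectation P (F k) (xi i) (cst 0)].

(* sup_i |xi i|_p as a function of p *)
Definition sup_pnorm (R : realType) (disp : measure_display)
    (T : measurableType disp) (P : probability T R) (n : option nat)
    (xi : nat -> T -> R) (p : R) : \bar R :=
  nnsup [set pnorm P p (xi i) | i in index_range n].

(* I(d, n), and b ranging over the real arrays indexed by it: the values of
   b outside I(d, n) are never used. *)
Definition Iset (d : nat) (n : option nat) : set (d.-tuple nat) :=
  [set I : d.-tuple nat | sorted ltn I /\
    forall m : 'I_d, index_range n (tnth I m)].

Arguments Iset d n : clear implicits.

Definition Bset (R : realType) (d : nat) (n : option nat)
    : set (d.-tuple nat -> R) :=
  [set b : d.-tuple nat -> R |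
    (\esum_(I in Iset d n) ((b I) ^+ 2)%:E = 1)%E].

Arguments Bset {R} d n.

(* The m-th entry of I, of (0-based) rank m, goes with the vector xi(., m+1). *)
Definition Qfin (R : realType) (T : Type) (xi : nat -> nat -> T -> R)
    (d N : nat) (b : d.-tuple nat -> R) (w : T) : R :=
  \sum_(I \in Iset d (Some N)) (b I * \prod_(m < d) xi (tnth I m) m.+1 w).

(* For n = oo this is meaningful for those b satisfying [Qexists]. *)
Definition Qpoly (R : realType) (T : Type) (xi : nat -> nat -> T -> R)
    (d : nat) (n : option nat) (b : d.-tuple nat -> R) (w : T) : R :=
  if n is Some N then Qfin xi N b w else limn (fun N => Qfin xi N b w).

Definition Qexists (R : realType) (disp : measure_display)
    (T : measurableType disp) (P : probability T R)
    (xi : nat -> nat -> T -> R)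
    (d : nat) (n : option nat) (b : d.-tuple nat -> R) : Prop :=
  if n is Some N then True
  else {ae P, forall w, cvgn (fun N => Qfin xi N b w)}.

Definition Gclass (R : realType) (r : R) (nu : R -> \bar R) : Prop :=
  [/\ {within `[1, r[%classic, continuous nu},
      forall p, 1 <= p -> p < r -> (0 < nu p < +oo)%E,
      (0 < ereal_inf [set nu p | p in `]2%R, r[%classic])%E &
      forall p, r < p -> nu p = +oo%E].

Definition otimes (R : realType) (nu1 nu2 : R -> \bar R) (p : R) : \bar R :=
  ereal_inf [set x | exists a b : R,
    [/\ 0 < a, 0 < b, a + b = 1 & x = (nu1 (p / a)%R * nu2 (p / b)%R)%E]].

(* K is admissible in the definition of K_M(p); K is universal, i.e. it
   serves all probability spaces and filtrations. *)
Definition KM_bound (R : realType) (p K : R) : Prop :=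
  forall (disp : measure_display) (T : measurableType disp)
    (P : probability T R) (F : nat -> set (set T)) (n : nat)
    (theta : nat -> T -> R) (b : nat -> R),
    is_filtration F ->
    martingale_differences P F (Some n) theta ->
    \sum_(1 <= i < n.+1) (b i) ^+ 2 = 1 ->
    (pnorm P p (fun w => (\sum_(1 <= i < n.+1) b i * theta i w)%R)
       <= K%:E * sup_pnorm P (Some n) theta p)%E.

Definition KM (R : realType) (p : R) : \bar R :=
  ereal_inf [set K%:E | K in [set K : R | KM_bound p K]].

(* [zeta nu m] is zeta_m for m >= 1, and a dummy for m = 0. *)
Fixpoint zeta (R : realType) (nu : nat -> R -> \bar R) (m : nat) (p : R)
    : \bar R :=
  match m with
  | 0 => 0%E
  | 1 => (KM p * nu 1%N p)%E
  | k.+1 => (KM p * otimes (zeta nu k) (nu k.+1) p)%E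
  end.

Definition Gnorm (R : realType) (disp : measure_display)
    (T : measurableType disp) (P : probability T R)
    (r : R) (psi : R -> \bar R) (X : T -> R) : \bar R :=
  nnsup [set (pnorm P p X / psi p)%E | p in `]2, r[%classic].

Definition Gnorm_vec (R : realType) (disp : measure_display)
    (T : measurableType disp) (P : probability T R) (n : option nat)
    (r : R) (nu : R -> \bar R) (xi : nat -> T -> R) : \bar R :=
  nnsup [set nnsup [set (pnorm P p (xi i) / nu p)%E | i in index_range n]
       | p in `]2, r[%classic].

(* Main.v *)
(* Only p > 2 matters, and both sides are compared with 1: the right-hand side
   is at least 1 because nu_m is itself the moment function of xi(., m), so it
   remains to prove |Q(d,n,b)|_p <= zeta_d(p).  Sorting the terms by their largest
   index, Q(m+1,N,b) = sum_i c_i theta_i with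
   theta_i = xi(i,m+1) Q(m,i-1,b(.,i)) / c_i and c_i^2 = sum_I b(I,i)^2.  The
   second factor of theta_i is F(i-1)-measurable, so the theta_i are again
   martingale differences, and Hoelder's inequality with exponents 1/a and 1/b
   bounds |theta_i|_p by zeta_m(p/a) nu_{m+1}(p/b), hence by the infimum
   zeta_m (x) nu_{m+1}; the definition of K_M closes the induction.  The case
   n = oo follows from Fatou's lemma.  No upper bound on K_M is needed: where
   K_M or the infimum is infinite, zeta is +oo, since the other factor is
   positive. *)
Require Import Defs.
From mathcomp Require Import all_boot all_order all_algebra.
From mathcomp Require Import all_classical all_reals all_analysis.
From mathcomp Require Import measurable_realfun ring lra.

Set Implicit Arguments.
Unset Strict Implicit.
Unset Printing Implicit Defensive.

Import Order.TTheory GRing.Theory Num.Theory.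
Import numFieldNormedType.Exports.
Local Open Scope classical_set_scope.
Local Open Scope ring_scope.

(** * Moments: monotonicity, Hölder's inequality, Fatou's lemma *)

Section pnorm_lemmas.
Context (R : realType) (disp : measure_display) (T : measurableType disp)
  (P : probability T R).
Implicit Types (p q : R) (X Y : T -> R).

Lemma pnormE p X :
  pnorm P p X = ((\int[P]_w ((`|X w| `^ p)%R)%:E) `^ p^-1)%E.
Proof. by rewrite /pnorm unlock. Qed.

Lemma pnorm_ge0 p X : (0 <= pnorm P p X)%E.
Proof. exact: Lnorm_ge0. Qed.

Lemma measurable_abs_powR p X : measurable_fun setT X ->
  measurable_fun setT (fun w => `|X w| `^ p).
Proof.
move=> mX; apply: (measurableT_comp (measurable_powR p)).
exact: measurableT_comp.
Qed.

Lemma pnormZ p (c : R) X : 0 < p -> measurable_fun setT X ->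
  pnorm P p (fun w => c * X w) = (`|c|%:E * pnorm P p X)%E.
Proof.
move=> p0 mX; rewrite !pnormE.
under eq_integral do rewrite normrM powRM// EFinM.
rewrite ge0_integralZl//; last first.
  by apply/measurable_EFinP; exact: measurable_abs_powR.
rewrite poweRM ?lee_fin ?powR_ge0//; last first.
  by apply: integral_ge0 => w _; rewrite lee_fin powR_ge0.
by rewrite poweR_EFin -powRrM mulfV ?gt_eqF// powRr1.
Qed.

Lemma pnorm0 p : 0 < p -> pnorm P p (fun=> 0) = 0%E.
Proof.
by move=> p0; rewrite /pnorm (_ : EFin \o _ = cst 0%E)// Lnorm0// eqe gt_eqF.
Qed.

Lemma pnorm1E X : pnorm P 1 X = (\int[P]_w `|(X w)%:E|)%E.
Proof. by rewrite /pnorm Lnorm1. Qed.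

(** Hölder's inequality against the constant 1, whose norm is 1 because [P] has total mass 1. The
    case [p = 1], where the conjugate exponent is infinite, is split off. *)
Lemma le_pnorm1 p X : 1 <= p -> measurable_fun setT X ->
  (pnorm P 1 X <= pnorm P p X)%E.
Proof.
rewrite le_eqVlt => /predU1P[<-//|p1] mX.
have p0 : 0 < p by apply: lt_trans p1.
have q0 : 0 < 1 - p^-1 by rewrite subr_gt0 invf_lt1.
have := @hoelder _ _ _ P X (cst 1) p (1 - p^-1)^-1 mX.
move=> /(_ (measurable_cst _) p0).
rewrite invr_gt0 invrK subrKC => /(_ q0 erefl).
rewrite (_ : EFin \o cst 1 = cst 1%E)// Lnorm_cst1.
rewrite [X in (X `^ _)%E](_ : _ = 1%E); last exact: probability_setT.
rewrite poweR1r mule1.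
by rewrite (_ : (X \* cst 1)%R = X)//; apply/funext => w /=; rewrite mulr1.
Qed.

Lemma pnorm_integrable p X : 1 <= p -> measurable_fun setT X ->
  (pnorm P p X < +oo)%E -> P.-integrable setT (EFin \o X).
Proof.
move=> p1 mX Xoo; apply/integrableP; split; first exact/measurable_EFinP.
by rewrite -pnorm1E; exact: le_lt_trans (le_pnorm1 p1 mX) Xoo.
Qed.

(** Hölder's inequality is applied to [|X|^p] and [|Y|^p] with the exponents [1/a] and [1/b],
    conjugate since [a + b = 1]; then the [p]-th root is taken. *)
Lemma pnorm_mul p (a b : R) X Y : 0 < p -> 0 < a -> 0 < b -> a + b = 1 ->
  measurable_fun setT X -> measurable_fun setT Y ->
  (pnorm P p (fun w => (X w * Y w)%R) <= pnorm P (p / a) X * pnorm P (p / b) Y)%E.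
Proof.
move=> p0 a0 b0 ab mX mY.
have powE c Z : 0 < c -> 
    'N[P]_(c^-1%:E)[EFin \o (fun w => (`|Z w| `^ p)%R)]%E =
    (pnorm P (p / c) Z `^ p)%E.
  move=> c0; rewrite pnormE unlock invrK -poweRrM.
  have -> : (p / c)^-1 * p = c by rewrite invf_div mulrVK// unitfE gt_eqF.
  by under eq_integral do rewrite /= ger0_norm ?powR_ge0// -powRrM.
have /(_ _ _ _) := @hoelder _ _ _ P (fun w => (`|X w| `^ p)%R) (fun w => (`|Y w| `^ p)%R) a^-1 b^-1
  (measurable_abs_powR p mX) (measurable_abs_powR p mY).
rewrite !invr_gt0 !invrK => /(_ a0 b0 ab).
rewrite !powE// -poweRM ?pnorm_ge0// => H.
have := @gt0_ler_poweR _ p^-1 _ _ _ _ _ H.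
rewrite invr_ge0 ltW// => /(_ isT); rewrite !in_itv/= !leey !andbT.
rewrite Lnorm_ge0 poweR_ge0 => /(_ isT isT).
rewrite -poweRrM mulfV ?gt_eqF// poweRe1 ?mule_ge0 ?pnorm_ge0//.
rewrite Lnorm1; suff -> : (\int[P]_w `|(EFin \o
  ((fun w => `|X w| `^ p) \* (fun w => `|Y w| `^ p))%R) w|
  = \int[P]_w ((`|X w * Y w| `^ p)%R)%:E)%E by rewrite -pnormE.
apply: eq_integral => w _ /=.
by rewrite ger0_norm ?mulr_ge0 ?powR_ge0// normrM powRM//.
Qed.

Import HBNNSimple.

(* [Y] need not be measurable: its lower integral is the one that counts. *)
Lemma pnorm_fatou p (X_ : nat -> T -> R) Y (Z : \bar R) : 0 < p ->
  (forall n, measurable_fun setT (X_ n)) ->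
  {ae P, forall w, X_ n w @[n --> \oo] --> Y w} ->
  (forall n, pnorm P p (X_ n) <= Z)%E -> (pnorm P p Y <= Z)%E.
Proof.
move=> p0 mX XY XZ.
have Z0 : (0 <= Z)%E := le_trans (pnorm_ge0 _ _) (XZ 0%N).
have powZ x : (0 <= x)%E -> ((x `^ p^-1) <= Z)%E -> (x <= Z `^ p)%E.
  move=> x0 xZ; rewrite -[leLHS]poweRe1// -[1](mulVf (lt0r_neq0 p0)) poweRrM.
  by apply: gt0_ler_poweR => //; rewrite ?ltW// in_itv/= ?leey ?andbT// poweR_ge0.
suff : (\int[P]_w ((`|Y w| `^ p)%R)%:E <= Z `^ p)%E.
  move=> YZ; rewrite pnormE -[Z]poweRe1// -[1](mulfV (lt0r_neq0 p0)) poweRrM.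
  apply: gt0_ler_poweR => //; rewrite ?invr_ge0 ?ltW// in_itv/= ?leey ?andbT.
    by apply: integral_ge0 => w _; rewrite lee_fin powR_ge0.
  exact: poweR_ge0.
have mpow n := measurable_abs_powR p (mX n).
pose L w := limn_einf (fun n => ((`|X_ n w| `^ p)%R)%:E).
have LZ : (\int[P]_w L w <= Z `^ p)%E.
  apply: le_trans (fatou P measurableT _ _) _.
  - by move=> n; apply/measurable_EFinP.
  - by move=> n w _; rewrite lee_fin powR_ge0.
  rewrite limn_einf_lim; apply: lime_le; first exact: is_cvg_einfs.
  apply: nearW => n; apply: ge_ereal_inf.
  exists (\int[P]_w ((`|X_ n w| `^ p)%R)%:E)%E; first by exists n => /=.
  by apply: powZ; rewrite ?integral_ge0// -pnormE.
have mL : measurable_fun setT L.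
  rewrite (_ : L = (fun w => - limn_esup (fun n => - ((`|X_ n w| `^ p)%R)%:E))%E).
    apply: measurableT_comp => //; apply: measurable_fun_limn_esup => n.
    by apply: measurableT_comp => //; apply/measurable_EFinP.
  by apply/funext => w; rewrite limn_esupN oppeK.
have L0 w : (0 <= L w)%E.
  rewrite /L limn_einf_lim; apply: lime_ge; first exact: is_cvg_einfs.
  apply: nearW => n; apply: le_ereal_inf_tmp => _ [k _ <-].
  by rewrite lee_fin powR_ge0.
apply: le_trans LZ; rewrite ge0_integralTE; last first.
  by move=> w; rewrite lee_fin powR_ge0.
(* The integral is a supremum over simple functions [h] below [|Y|^p]. Each [h] is measurable and
   almost everywhere at most [L], so monotonicity applies to [h] although it might not to [|Y|^p]
   itself. *)
apply: ge_ereal_sup => _ [h hY <-]; rewrite -integralT_nnsfun.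
apply: ae_ge0_le_integral => //.
- by move=> w _; rewrite lee_fin.
- exact/measurable_EFinP.
apply: filterS XY => w XYw _; apply: le_trans (hY w) _.
(* Continuity of the power is derived below from its differentiability, which holds away from 0; at
   0 only [0 <= L w] is to be checked. *)
have [Y0|Y0] := eqVneq `|Y w| 0; first by rewrite Y0 powR0 ?gt_eqF.
have {}Y0 : 0 < `|Y w| by rewrite lt_neqAle eq_sym Y0 normr_ge0.
have Xw : `|X_ n w| @[n --> \oo] --> `|Y w| by exact: cvg_norm.
have powc : {for `|Y w|, continuous (fun a : R => a `^ p)}.
  apply/differentiable_continuous/derivable1_diffP/derivable_powR.
  by rewrite in_itv/= Y0.
rewrite /L (_ : limn_einf _ = (`|Y w| `^ p)%:E)//.
apply: (cvg_limn_einf_sup _).1; apply: cvg_EFin; first exact: nearW.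
exact: (continuous_cvg _ powc Xw).
Qed.
End pnorm_lemmas.

(** * Integration against functions measurable for a sub-sigma-algebra *)

Section sub_sigma_algebra.
Context (R : realType) (disp : measure_display) (T : measurableType disp)
  (P : probability T R) (G : set (set T)) (sG : sigma_algebra setT G).
Implicit Types (X Y : T -> R).

(** Transfers the closure properties of measurable functions to [measurable_wrt]; it works because
    [G] is the sigma-algebra that it generates. *)
Lemma measurable_wrtP X : measurable_wrt G X <->
  measurable_fun setT (X : g_sigma_algebraType G -> R).
Proof.
have GE : <<s G>> = G := sigma_algebra_id sG.
split=> [GX _ B mB|GX B mB].
  by rewrite setTI /measurable/= GE; exact: GX.
by have := GX measurableT B mB; rewrite setTI /measurable/= GE.
Qed.

Lemma measurable_wrt_measurable X : G `<=` measurable ->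
  measurable_wrt G X -> measurable_fun setT X.
Proof. by move=> Gm GX _ B mB; rewrite setTI; exact/Gm/GX. Qed.

Lemma g_sigma_measurable A : measurable (A : set (g_sigma_algebraType G)) -> G A.
Proof. by rewrite /measurable/= (sigma_algebra_id sG). Qed.

Import HBNNSimple.

(** The right-hand side sees [f] only through its integrals over level sets of [G]-measurable simple
    functions, that is, over sets of [G]. Hence two densities that agree on [G] can be exchanged. *)
Lemma ge0_integralM_approx (h : T -> R)
    (mh : measurable_fun setT (EFin \o h : g_sigma_algebraType G -> \bar R))
    (a := nnsfun_approx measurableT mh) (f : T -> R) :
  G `<=` measurable -> (forall w, 0 <= h w) ->
  measurable_fun setT f -> (forall w, 0 <= f w) ->
  (\int[P]_w ((h w)%:E * (f w)%:E) =
   limn (fun n => \sum_(y \in range (a n))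
     y%:E * \int[P]_(w in a n @^-1` [set y]) (f w)%:E))%E.
Proof.
move=> Gm h0 mf f0.
have ma n y : disp.-measurable (a n @^-1` [set y] : set T).
  by apply/Gm/g_sigma_measurable; exact: measurable_sfunP.
have ma_ n : measurable_fun setT (a n : T -> R).
  apply: (measurable_wrt_measurable Gm); apply/measurable_wrtP.
  exact: measurable_funPT.
have hfE w : ((h w)%:E * (f w)%:E = limn (fun n => (a n w)%:E * (f w)%:E))%E.
  apply/esym/cvg_lim => //.
  apply: cvgeZr => //.
  by apply: (cvg_nnsfun_approx measurableT mh) => // x _; rewrite lee_fin.
under eq_integral do rewrite hfE.
rewrite monotone_convergence//; last 3 first.
- by move=> n; apply: emeasurable_funM; exact/measurable_EFinP.
- by move=> n w _; rewrite mule_ge0// lee_fin.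
- move=> w _ m n mn; rewrite lee_wpmul2r ?lee_fin//.
  by have /lefP := nd_nnsfun_approx measurableT mh mn; exact.
apply: congr_lim; apply/funext => n.
transitivity (\int[P]_w (\sum_(y \in range (a n))
    (y * \1_(a n @^-1` [set y]) w)%:E * (f w)%:E))%E.
  apply: eq_integral => w _.
  rewrite -ge0_mule_fsuml => [|y]; last exact: nnfun_muleindic_ge0.
  by rewrite fsumEFin// [X in X%:E]fimfunE.
rewrite ge0_integral_fsum//; last 2 first.
- move=> z; apply: emeasurable_funM; apply/measurable_EFinP => //.
  by apply: measurable_funM => //; exact: measurable_indic.
- move=> z w _; apply: mule_ge0; last by rewrite lee_fin.
  exact: nnfun_muleindic_ge0.
apply: eq_fsbigr => y; rewrite inE => -[w0 _ yE].
under eq_integral do rewrite EFinM -muleA.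
rewrite ge0_integralZl//; last 3 first.
- apply: emeasurable_funM; apply/measurable_EFinP => //.
- by move=> w _; rewrite mule_ge0// lee_fin.
- by rewrite -yE lee_fin.
congr (_ * _)%E; rewrite [RHS]integral_mkcond.
by apply: eq_integral => w _; rewrite epatch_indic muleC.
Qed.

Lemma ge0_eq_integralM (f g : T -> R) (h : T -> R) :
  G `<=` measurable -> measurable_wrt G h -> (forall w, 0 <= h w) ->
  measurable_fun setT f -> (forall w, 0 <= f w) ->
  measurable_fun setT g -> (forall w, 0 <= g w) ->
  (forall A, G A -> \int[P]_(w in A) (f w)%:E = \int[P]_(w in A) (g w)%:E)%E ->
  (\int[P]_w ((h w)%:E * (f w)%:E) = \int[P]_w ((h w)%:E * (g w)%:E))%E.
Proof.
move=> Gm /measurable_wrtP/measurable_EFinP mh h0 mf f0 mg g0 fg.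
rewrite !(ge0_integralM_approx mh)//.
apply: congr_lim; apply/funext => n; apply: eq_fsbigr => y _; congr (_ * _)%E.
by apply/fg/g_sigma_measurable; exact: measurable_sfunP.
Qed.

(* The positive and the negative parts of [X] are densities of the same measure
   on [G], so a [G]-measurable [h] has the same integral against both. *)
Lemma integralM_cond0 X h : G `<=` measurable -> measurable_wrt G h ->
  is_cond_expectation P G X (cst 0) ->
  P.-integrable setT (fun w => (h w * X w)%:E) ->
  (\int[P]_w (h w * X w)%:E = 0)%E.
Proof.
move=> Gm mh [iX _ _ X0] ihX.
have mX : measurable_fun setT X by apply/measurable_EFinP; exact: measurable_int iX.
have mh' := measurable_wrt_measurable Gm mh.
pose Xp := fun w => Num.max (X w) 0; pose Xn := fun w => Num.max (- X w) 0.
have XE w : X w = Xp w - Xn w.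
  by rewrite /Xp /Xn; case: (leP (X w) 0); case: (leP (- X w) 0); lra.
have mXp : measurable_fun setT Xp by exact: measurable_maxr.
have mXn : measurable_fun setT Xn.
  by apply: measurable_maxr => //; exact: measurableT_comp.
have Xp0 w : 0 <= Xp w by rewrite le_max lexx orbT.
have Xn0 w : 0 <= Xn w by rewrite le_max lexx orbT.
have XpX w : Xp w <= `|X w| by rewrite ge_max ler_norm normr_ge0.
have XnX w : Xn w <= `|X w| by rewrite ge_max -normrN ler_norm normr_ge0.
(* The integrability of [h * X] dominates every product of a part of [h] with a part of [X], so all
   the differences of integrals below make sense. *)
have iXM (g Y : T -> R) : measurable_fun setT g -> measurable_fun setT Y ->
    (forall w, `|g w| <= `|h w|) -> (forall w, `|Y w| <= `|X w|) ->
    P.-integrable setT (fun w => (g w)%:E * (Y w)%:E)%E.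
  move=> mg mY gh YX; apply: (le_integrable _ _ _ ihX) => //.
    by apply: emeasurable_funM; exact/measurable_EFinP.
  by move=> w _; rewrite /= lee_fin !normrM ler_pM.
have iXS Y : measurable_fun setT Y -> (forall w, `|Y w| <= `|X w|) ->
    P.-integrable setT (EFin \o Y).
  move=> mY YX; apply: (le_integrable _ _ _ iX) => //.
    exact/measurable_EFinP.
  by move=> w _; rewrite /= lee_fin.
have Xpn A : G A -> (\int[P]_(w in A) (Xp w)%:E = \int[P]_(w in A) (Xn w)%:E)%E.
  move=> GA; have mA := Gm _ GA.
  have ip : P.-integrable A (EFin \o Xp).
    apply: (integrableS measurableT) => //; apply: iXS => // w.
    by rewrite ger0_norm.
  have im : P.-integrable A (EFin \o Xn).
    apply: (integrableS measurableT) => //; apply: iXS => // w.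
    by rewrite ger0_norm.
  have := X0 _ GA; rewrite integral0.
  under eq_integral do rewrite XE EFinB.
  rewrite integralB// => /esym/eqP.
  rewrite sube_eq ?add0e; last 2 first.
  - exact: integrable_fin_num ip.
  - by rewrite fin_num_adde_defl//; exact: integrable_fin_num im.
  by move=> /eqP.
(* Here [g] stands for the positive or the negative part on the real line, so that [g \o h] is a
   nonnegative [G]-measurable weight. *)
have hXpn (g : R -> R) : measurable_fun setT g ->
    (forall x, 0 <= g x) -> (forall x, `|g x| <= `|x|) ->
    (\int[P]_w ((g (h w))%:E * (X w)%:E) = 0)%E.
  move=> mg g0 gx.
  have mgh : measurable_fun setT (g \o h) by exact: measurableT_comp.
  under eq_integral do rewrite XE EFinB muleBr//.
  have Xpi := iXM _ _ mgh mXp (fun w => gx (h w))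
    (fun w => eq_ind_r (fun x => x <= _) (XpX w) (ger0_norm (Xp0 w))).
  have Xni := iXM _ _ mgh mXn (fun w => gx (h w))
    (fun w => eq_ind_r (fun x => x <= _) (XnX w) (ger0_norm (Xn0 w))).
  rewrite integralB//.
  rewrite (@ge0_eq_integralM Xp Xn (g \o h))//.
    by rewrite subee//; exact: integrable_fin_num.
  - move=> B mB; rewrite comp_preimage; apply: mh.
    by rewrite -[_ @^-1` _]setTI; exact: mg.
  - by move=> w; exact: g0.
pose gp := fun x : R => Num.max x 0; pose gn := fun x : R => Num.max (- x) 0.
have hE w : h w = gp (h w) - gn (h w).
  by rewrite /gp /gn; case: (leP (h w) 0); case: (leP (- h w) 0); lra.
have mgp : measurable_fun setT gp by exact: measurable_maxr.
have mgn : measurable_fun setT gn.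
  by apply: measurable_maxr => //; exact: oppr_measurable.
have gp0 x : 0 <= gp x by rewrite le_max lexx orbT.
have gn0 x : 0 <= gn x by rewrite le_max lexx orbT.
have gpx x : `|gp x| <= `|x| by rewrite ger0_norm// ge_max ler_norm normr_ge0.
have gnx x : `|gn x| <= `|x|.
  by rewrite ger0_norm// ge_max -normrN ler_norm normr_ge0.
under eq_integral do rewrite hE EFinM EFinB muleBl//.
rewrite integralB//; last 2 first.
- exact: (iXM (gp \o h) _ (measurableT_comp mgp mh') mX (fun w => gpx _)).
- exact: (iXM (gn \o h) _ (measurableT_comp mgn mh') mX (fun w => gnx _)).
by rewrite !hXpn// sube0.
Qed.
End sub_sigma_algebra.

(** * The constant [KM]: lower bound and use *)

Section martingale_constant.
Context (R : realType).

(* A single Rademacher variable. *)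
Lemma KM_ge1 (p : R) : 0 < p -> (1 <= KM p)%E.
Proof.
move=> p0; apply: le_ereal_inf_tmp => _ [K KK <-].
have half01 : 0 <= (2^-1 : R) <= 1 by apply/andP; split; lra.
pose e (w : bool) : R := if w then 1 else -1.
(* Trivial at time 0 and full from time 1 on: with one term, only the trivial sigma-algebra has to
   be tested against [e]. *)
pose F i : set (set bool) := if i is 0 then [set set0; setT] else setT.
pose B := bernoulli_prob 2^-1 : probability bool R.
have mbool (f : bool -> R) : measurable_fun setT f by [].
have bool_integrable (f : bool -> R) : B.-integrable setT (EFin \o f).
  apply/integrableP; split; first exact/measurable_EFinP.
  by rewrite integral_bernoulli_prob//= -!EFinM -EFinD ltry.
have int_e : (\int[B]_w (e w)%:E = 0)%E.
  rewrite integralE !integral_bernoulli_prob// !funeposE !funenegE /=.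
  rewrite -!EFin_max opprK.
  rewrite (max_l ler01) (max_r (lerN10 _)) -!EFinM -!EFinD -?EFinN -?EFinD.
  by congr EFin; rewrite /unstable.onem; lra.
have eK : pnorm B p e = 1%E.
  rewrite pnormE integral_bernoulli_prob//= normrN1 normr1 powR1.
  rewrite (_ : _ + _ = 1) ?powR1//.
  by rewrite /unstable.onem; lra.
have F_filt : is_filtration F.
  split=> //.
  - case=> [|i]; split => //=.
    + by left.
    + by move=> A [->|->]; rewrite ?setTD ?setC0 ?setCT; [right|left].
    + move=> A AF; have [[i Ai]|A0] := pselect (exists i, A i = setT).
        right; apply/seteqP; split => // w _; exists i => //; rewrite Ai//.
      left; apply/seteqP; split => // w [i _].
      by have [->//|Ai] := AF i; case: A0; exists i.
have e_mart : martingale_differences B F (Some 1%N) (fun=> e).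
  move=> [|[|i]] []//= _ _; split => //.
    by rewrite unlock.
  move=> [|k]//= _; split => //.
  - move=> A _; have [A0|A0] := pselect (A 0); [right|left].
      by apply/seteqP; split.
    by apply/seteqP; split.
  - by move=> A [->|->]; rewrite ?integral_set0// int_e integral0_eq.
have := KK _ _ B F 1%N (fun=> e) (fun=> 1) F_filt e_mart.
rewrite !big_nat1 expr1n => /(_ erefl).
under eq_fun do rewrite big_nat1 mul1r.
rewrite eK (_ : sup_pnorm _ _ _ _ = 1%E) ?mule1//.
apply/eqP; rewrite eq_le; apply/andP; split.
  by apply: ge_ereal_sup => _ [->//|[i _ <-]]; rewrite eK.
by apply: ereal_sup_ubound; right; exists 1%N.
Qed.

(** Brings the definition of [KM] to the form used in the induction: the coefficients may have
    square sum below 1, by rescaling, and the supremum of the moments is replaced by any finite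
    positive bound. *)
Lemma KM_le (p : R) (disp : measure_display) (T : measurableType disp)
    (P : probability T R) (F : nat -> set (set T)) (n : nat)
    (theta : nat -> T -> R) (b : nat -> R) (Z : \bar R) : 1 <= p ->
  is_filtration F -> martingale_differences P F (Some n) theta ->
  \sum_(1 <= i < n.+1) (b i) ^+ 2 <= 1 ->
  (forall i, (0 < i <= n)%N -> pnorm P p (theta i) <= Z)%E -> (0 < Z < +oo)%E ->
  (pnorm P p (fun w => (\sum_(1 <= i < n.+1) b i * theta i w)%R) <= KM p * Z)%E.
Proof.
move=> p1 hF mth b1 thZ /andP[Z0 Zoo].
have p0 : 0 < p by lra.
have KM0 : (0 < KM p)%E by rewrite (lt_le_trans _ (KM_ge1 p0)).
pose s := Num.sqrt (\sum_(1 <= i < n.+1) (b i) ^+ 2).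
have sum0 : 0 <= \sum_(1 <= i < n.+1) (b i) ^+ 2.
  by apply: sumr_ge0 => i _; rewrite sqr_ge0.
have s0 : 0 <= s by rewrite sqrtr_ge0.
have s1 : s <= 1 by rewrite -sqrtr1 ler_sqrt.
have sE : s ^+ 2 = \sum_(1 <= i < n.+1) (b i) ^+ 2 by rewrite sqr_sqrtr.
have mtheta i : (0 < i <= n)%N -> measurable_fun setT (theta i).
  move=> ib; have [_ i_ _ _] := mth i (elimT andP ib).
  exact/measurable_EFinP/(measurable_int _ i_).
(* If [s = 0] the coefficients cannot be normalised, but then they all vanish and so does the
   sum. *)
have [sz|sn] := eqVneq s 0.
  rewrite (_ : (fun w => _) = fun=> 0); last first.
    apply/funext => w; rewrite big_nat big1// => i /andP[i0 ib].
    have := sE; rewrite sz expr0n/= => /esym/eqP.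
    rewrite psumr_eq0; last by move=> j _; rewrite sqr_ge0.
    move=> /allP /(_ i); rewrite mem_index_iota i0 ib => /(_ isT)/=.
    by rewrite sqrf_eq0 => /eqP ->; rewrite mul0r.
  by rewrite pnorm0// mule_ge0// ltW.
rewrite (_ : (fun w => _) = fun w => s * (\sum_(1 <= i < n.+1) (b i / s) * theta i w)); last first.
  by apply/funext => w; rewrite mulr_sumr; apply: eq_bigr => i _; field.
rewrite pnormZ//; last first.
  under eq_fun do rewrite big_add1 big_mkord.
  apply: measurable_sum => i; apply: measurable_funM => //.
  by apply: mtheta; rewrite /= ltn_ord.
rewrite ger0_norm// (le_trans (lee_wpmul2r (pnorm_ge0 _ _ _) (_ : s%:E <= 1)%E)) ?lee_fin// mul1e.
have Zfin : Z \is a fin_num by rewrite ge0_fin_numE ?ltW.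
(* After division by [Z] the claim is a lower bound for an infimum, to be tested on each admissible
   [K]; this covers the case where no [K] is admissible and [KM p] is infinite. *)
rewrite -(fineK Zfin) -lee_pdivrMr; last by rewrite -lte_fin fineK.
apply: le_ereal_inf_tmp => _ [K KK <-].
rewrite lee_pdivrMr; last by rewrite -lte_fin fineK.
rewrite fineK//.
have K1 : (1 <= K%:E)%E by apply: le_trans (KM_ge1 p0) _; apply: ereal_inf_lbound; exists K.
apply: (le_trans (KK _ _ P F n theta (fun i => b i / s) hF mth _)).
  under eq_bigr do rewrite expr_div_n.
  by rewrite -mulr_suml -sE mulfV// expf_eq0.
apply: lee_wpmul2l; first by rewrite (le_trans _ K1).
apply: ge_ereal_sup => _ [->|[i ib <-]]; first exact: ltW.
exact/thZ/andP.
Qed.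
End martingale_constant.

(** * Increasing multi-indices, split by their last entry *)

Section increasing_tuples.

(** A form of the two conditions that decomposes along [rcons]. *)
Lemma IsetP (m N : nat) (I : m.-tuple nat) : Iset m (Some N) I <->
  pairwise ltn I /\ {in I, forall i, (0 < i <= N)%N}.
Proof.
rewrite -sorted_pairwise; last exact: ltn_trans.
split=> -[sI IN]; split=> //.
  by move=> i /tnthP[j ->]; apply/andP; exact: IN.
by move=> j; apply/andP; apply: IN; exact: mem_tnth.
Qed.

Lemma finite_Iset (m N : nat) : finite_set (Iset m (Some N)).
Proof.
apply: (@sub_finite_set _ _
  (range (fun t : m.-tuple 'I_N.+1 => map_tuple val t))); last first.
  exact/finite_image/finite_finset.
move=> I /IsetP[_ IN]; exists (map_tuple inord I) => //.
apply/val_inj => /=; rewrite -map_comp map_id_in// => i /IN /andP[_ iN] /=.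
by rewrite inordK.
Qed.

Lemma Iset0 (N : nat) : Iset 0 (Some N) = [set [tuple]].
Proof.
apply/seteqP; split=> [t _|_ ->]; first by rewrite [t]tuple0.
by apply/IsetP.
Qed.

Lemma Iset_rcons (m N x : nat) (I : m.-tuple nat) :
  Iset m.+1 (Some N) (rcons_tuple I x) <->
  (0 < x <= N)%N /\ Iset m (Some x.-1) I.
Proof.
split.
  move=> /IsetP[/=]; rewrite pairwise_rcons => /andP[/allP Ix pI] IN.
  have xN : (0 < x <= N)%N by apply: IN; rewrite mem_rcons mem_head.
  split=> //; apply/IsetP; split=> // i iI.
  have /andP[-> _] : (0 < i <= N)%N by apply: IN; rewrite mem_rcons in_cons iI orbT.
  by case/andP: xN => x0 _; rewrite /= -ltnS prednK//; exact: Ix.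
move=> [/andP[x0 xN] /IsetP[pI Ix]]; apply/IsetP; split=> /=.
  rewrite pairwise_rcons pI andbT; apply/allP => i /Ix /andP[_ ix].
  by rewrite /= -(prednK x0) ltnS.
move=> i; rewrite mem_rcons in_cons => /predU1P[->|/Ix /andP[-> /=]].
  by rewrite x0.
by move=> ix; rewrite (leq_trans ix)// (leq_trans _ xN)// leq_pred.
Qed.

Lemma tuple_rconsP (T : Type) (m : nat) (t : m.+1.-tuple T) :
  exists (I : m.-tuple T) x, t = rcons_tuple I x.
Proof.
case: t => t; case: (lastP t) => [//|s x] ts.
have ss : size s == m by rewrite size_rcons in ts.
by exists (Tuple ss), x; apply: val_inj.
Qed.

Lemma rcons_tuple_inj (T : Type) (m : nat) (I J : m.-tuple T) x y :
  rcons_tuple I x = rcons_tuple J y -> I = J /\ x = y.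
Proof.
by move=> /(congr1 val)/= /rcons_inj[IJ ->]; split=> //; exact: val_inj.
Qed.

(** By induction on [N]: the tuples bounded by [N.+1] are those bounded by [N] and, disjointly,
    those that end in [N.+1] and are otherwise bounded by [N]. *)
Lemma fsum_Iset_rcons (V : nmodType) (m N : nat) (f : m.+1.-tuple nat -> V) :
  \sum_(I \in Iset m.+1 (Some N)) f I =
  \sum_(1 <= i < N.+1) \sum_(I \in Iset m (Some i.-1)) f (rcons_tuple I i).
Proof.
elim: N => [|N IH].
  rewrite big_nil fsbig1// => t tN.
  have [I [x tE]] := tuple_rconsP t; move: tN; rewrite tE => /Iset_rcons[/andP[x0]].
  by rewrite leqNgt x0.
rewrite big_nat_recr//= -IH.
rewrite (_ : Iset m.+1 (Some N.+1) = Iset m.+1 (Some N) `|`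
    (fun I => rcons_tuple I N.+1) @` Iset m (Some N)).
  rewrite fsbigU0 /=; last 3 first.
  - exact: finite_Iset.
  - exact/finite_image/finite_Iset.
  - move=> t [+ [I _ tE]]; rewrite -tE => /Iset_rcons[].
    by rewrite ltnn andbF.
  by rewrite fsbig_image// => I J _ _ e; case: (rcons_tuple_inj e).
apply/seteqP; split=> t; have [I [x ->]] := tuple_rconsP t.
  move=> /Iset_rcons[/andP[x0]]; rewrite leq_eqVlt ltnS => /predU1P[->|xN] II.
    by right; exists I.
  by left; apply/Iset_rcons; rewrite x0 xN.
move=> [/Iset_rcons[/andP[x0 xN] II]|[J JN e]]; last first.
  by case: (rcons_tuple_inj e) => <- <-; apply/Iset_rcons; rewrite leqnn.
by apply/Iset_rcons; rewrite x0 (leq_trans xN).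
Qed.

End increasing_tuples.

(** * Recursion of the polynomial in its degree *)

Section polynomial.
Context (R : realType) (T : Type) (xi : nat -> nat -> T -> R).

Lemma Qfin0 (N : nat) (b : 0.-tuple nat -> R) : Qfin xi N b = fun=> b [tuple].
Proof.
by apply/funext => w; rewrite /Qfin Iset0 fsbig_set1 big_ord0 mulr1.
Qed.

Lemma QfinZ (d N : nat) (c : R) (b : d.-tuple nat -> R) w :
  Qfin xi N (fun I => c * b I) w = c * Qfin xi N b w.
Proof. by rewrite /Qfin mulr_fsumr; apply: eq_fsbigr => I _; rewrite mulrA. Qed.

Lemma QfinS (m N : nat) (b : m.+1.-tuple nat -> R) w :
  Qfin xi N b w = \sum_(1 <= i < N.+1)
    xi i m.+1 w * Qfin xi i.-1 (fun I => b (rcons_tuple I i)) w.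
Proof.
rewrite /Qfin fsum_Iset_rcons; apply: eq_bigr => i _.
rewrite mulr_fsumr; apply: eq_fsbigr => I _; rewrite big_ord_recr/=.
rewrite [RHS]mulrC -mulrA; congr (_ * (_ * _)).
  apply: eq_bigr => j _; congr (xi _ _ _).
  by rewrite !(tnth_nth 0%N)/= nth_rcons size_tuple ltn_ord.
by congr (xi _ _ _); rewrite (tnth_nth 0%N)/= nth_rcons size_tuple ltnn eqxx.
Qed.

End polynomial.

(** * Square sums of the coefficients *)

Section square_sum.
Context (R : realType).

Definition sqsum m N (b : m.-tuple nat -> R) : R := \sum_(I \in Iset m (Some N)) b I ^+ 2.

Lemma sqsum_ge0 m N (b : m.-tuple nat -> R) : 0 <= sqsum N b.
Proof. by apply: fsumr_ge0 => I _; exact: sqr_ge0. Qed.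

(** Serves the indices whose normalising constant vanishes, where no division is possible. *)
Lemma Qfin_sqsum0 (T : Type) (xi : nat -> nat -> T -> R) m N (b : m.-tuple nat -> R) w :
  sqsum N b = 0 -> Qfin xi N b w = 0.
Proof.
move=> b0; rewrite /Qfin fsbig1// => I NI.
have : b I ^+ 2 = 0.
  by apply: (pfsumr_eq0 (@finite_Iset _ _) _ b0) => // J _; exact: sqr_ge0.
by move/eqP; rewrite sqrf_eq0 => /eqP ->; rewrite mul0r.
Qed.

End square_sum.

(** * Martingale structure and moment bound by induction on the degree *)

Section moment_bound.
Context (R : realType) (disp : measure_display) (T : measurableType disp)
  (P : probability T R) (n : option nat) (F : nat -> set (set T))
  (hF : is_filtration F).

Lemma filtration_le i j : (i <= j)%N -> F i `<=` F j.
Proof.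
have [_ _ FS _] := hF.
by elim: j => [|j IH]; rewrite leq_eqVlt ?ltnS => /predU1P[->//|//] /IH/subset_trans; exact.
Qed.

Lemma measurable_wrt_filtration_le i j (X : T -> R) : (i <= j)%N ->
  measurable_wrt (F i) X -> measurable_wrt (F j) X.
Proof. by move=> ij mX B mB; apply: (filtration_le ij); exact: mX. Qed.

Lemma measurable_wrtM i (X Y : T -> R) :
  measurable_wrt (F i) X -> measurable_wrt (F i) Y ->
  measurable_wrt (F i) (fun w => X w * Y w).
Proof.
have [_ sF _ _] := hF.
move=> /(measurable_wrtP (sF i)) mX /(measurable_wrtP (sF i)) mY.
by apply/(measurable_wrtP (sF i)); exact: measurable_funM.
Qed.

(** A martingale transform by a predictable sequence. On a set [A] of [F i.-1] the indicator of [A]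
    is absorbed into the factor [H i], which stays [F i.-1]-measurable. *)
Lemma martingale_differencesM (X H : nat -> T -> R) :
  martingale_differences P F n X ->
  (forall i, index_range n i -> measurable_wrt (F i.-1) (H i)) ->
  (forall i, index_range n i ->
     P.-integrable setT (EFin \o (fun w => X i w * H i w))) ->
  martingale_differences P F n (fun i w => X i w * H i w).
Proof.
have [F0 sF FS Fm] := hF.
move=> mX mH iXH i ni; have [mXi iX _ Xi0] := mX i ni.
have i0 : (0 < i)%N by case: ni.
(* This identity yields both remaining claims: [A = setT] gives the zero mean, and [F k] is
   contained in [F i.-1] for [k < i]. *)
have XH0 A : F i.-1 A -> (\int[P]_(w in A) (X i w * H i w)%:E = 0)%E.
  move=> FA; rewrite integral_mkcond.
  have mA : measurable_wrt (F i.-1) (\1_A : T -> R).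
    apply/(measurable_wrtP (sF i.-1)); apply: measurable_indic.
    by rewrite /measurable/= (sigma_algebra_id (sF i.-1)).
  rewrite -[RHS](@integralM_cond0 _ _ _ P (F i.-1) (sF _) (X i)
    (fun w => H i w * \1_A w)).
  - apply: eq_integral => w _; rewrite patchE indicE.
    by case: ifPn => _; rewrite ?mulr1 ?mulr0 ?mul0r// mulrC.
  - exact: Fm.
  - by apply: measurable_wrtM => //; exact: mH.
  - by apply: Xi0; rewrite prednK.
  - apply: (le_integrable measurableT _ _ (iXH i ni)).
      apply/measurable_EFinP; apply: measurable_funM.
        apply: measurable_funM.
          exact: measurable_wrt_measurable (Fm _) (mH _ ni).
        exact: measurable_wrt_measurable (Fm _) mA.
      exact: measurable_wrt_measurable (Fm _) mXi.
    move=> w _; rewrite /= lee_fin mulrAC [H i w * _]mulrC normrM ler_piMr//.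
    by rewrite indicE; case: (_ \in _); rewrite ?normr1 ?normr0.
split.
- apply: measurable_wrtM => //.
  by apply: (measurable_wrt_filtration_le (leq_pred i)); exact: mH.
- exact: iXH.
- by rewrite unlock; apply: XH0; have [s0 sC _] := sF i.-1; rewrite -(setD0 setT); exact: sC.
- move=> k ki; split.
  + exact: iXH.
  + exact: integrable0.
  + by apply/(measurable_wrtP (sF k)); exact: measurable_cst.
  + move=> A FA; rewrite integral0 XH0//; apply: (filtration_le _ FA).
    by rewrite -ltnS prednK.
Qed.

Context (xi : nat -> nat -> T -> R) (d : nat)
  (hxi : forall m, (1 <= m <= d)%N ->
     martingale_differences P F n (fun i => xi i m)).

Lemma measurable_xi m i : (1 <= m <= d)%N -> index_range n i ->
  measurable_fun setT (xi i m).
Proof.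
move=> md ni; have [_ ix _ _] := hxi md ni.
exact/measurable_EFinP/(measurable_int _ ix).
Qed.

Lemma index_range_pred i : index_range n i ->
  index_range (Some i.-1) `<=` index_range n.
Proof.
move=> [i0 ni] j [j0 ji]; split => //.
by case: n ni => // N ni; rewrite (leq_trans ji)// (leq_trans _ ni)// leq_pred.
Qed.

Lemma measurable_wrt_Qfin m N b : (m <= d)%N ->
  index_range (Some N) `<=` index_range n ->
  measurable_wrt (F N) (@Qfin _ _ xi m N b).
Proof.
have [_ sF _ _] := hF.
elim: m N b => [|m IH] N b md Nn.
  by rewrite Qfin0; apply/(measurable_wrtP (sF N)); exact: measurable_cst.
rewrite (_ : Qfin xi N b = fun w => \sum_(i < N)
    (xi i.+1 m.+1 w * Qfin xi i (fun I => b (rcons_tuple I i.+1)) w)); last first.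
  by apply/funext => w; rewrite QfinS big_add1 big_mkord.
apply/(measurable_wrtP (sF N)); apply: measurable_sum => i.
apply/(measurable_wrtP (sF N)); apply: measurable_wrtM.
  apply: (@measurable_wrt_filtration_le i.+1); first exact: ltn_ord.
  have iN : index_range (Some N) i.+1 by split=> //=; exact: ltn_ord.
  by have [] := @hxi m.+1 md _ (Nn _ iN).
apply: (@measurable_wrt_filtration_le i); first exact/ltnW/ltn_ord.
apply: IH; first exact: ltnW.
by move=> j [j0 ji]; apply: Nn; split=> //=; apply: leq_trans ji _; exact/ltnW/ltn_ord.
Qed.

(** The passage from degree [m] to [m + 1], with an abstract bound [Z] so that it serves both the
    base case, [Z = nu 1 p], and the inductive case, [Z] a value of [otimes]. *)
Lemma pnorm_Qfin_step m (p : R) (Z : \bar R) : (m < d)%N -> 1 <= p ->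
  (0 < Z)%E ->
  (forall i (b : m.-tuple nat -> R), index_range n i -> sqsum i.-1 b <= 1 ->
    (pnorm P p (fun w => (xi i m.+1 w * Qfin xi i.-1 b w)%R) <= Z)%E) ->
  forall N (b : m.+1.-tuple nat -> R),
    index_range (Some N) `<=` index_range n ->
    sqsum N b <= 1 -> (pnorm P p (Qfin xi N b) <= KM p * Z)%E.
Proof.
move=> md p1 Z_gt0 HZ N b Nn b1.
(* For infinite [Z] the right-hand side is infinite because [KM p >= 1]. Finiteness of [Z] is what
   later makes each [theta i] integrable. *)
have [->|Zoo] := eqVneq Z +oo%E.
  by rewrite gt0_muley ?leey// (lt_le_trans _ (KM_ge1 _))//; lra.
have Z0 : (0 < Z < +oo)%E by rewrite Z_gt0 ltey.
pose bi i (I : m.-tuple nat) := b (rcons_tuple I i).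
pose c i := Num.sqrt (sqsum i.-1 (bi i)).
have cE i : c i ^+ 2 = sqsum i.-1 (bi i) by rewrite sqr_sqrtr// sqsum_ge0.
(* If [c i = 0] then its inverse is 0 by convention, so [ci i] is the zero array and its square sum
   is still at most 1. *)
pose ci i I := (c i)^-1 * bi i I.
pose theta i w := xi i m.+1 w * Qfin xi i.-1 (ci i) w.
have ci1 i : sqsum i.-1 (ci i) <= 1.
  rewrite /sqsum; under eq_fsbigr do rewrite exprMn.
  rewrite -mulr_fsumr -/(sqsum _ _) -cE -exprMn.
  by have [->|c0] := eqVneq (c i) 0; rewrite ?mulr0 ?expr0n// mulVf// expr1n.
have mQ i : index_range n i -> measurable_wrt (F i.-1) (Qfin xi i.-1 (ci i)).
  by move=> ni; apply: measurable_wrt_Qfin; [exact: ltnW|exact: index_range_pred].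
have mQ' i : index_range n i -> measurable_fun setT (Qfin xi i.-1 (ci i)).
  have [_ _ _ Fm] := hF.
  by move=> ni; apply: measurable_wrt_measurable (mQ _ ni); exact: Fm.
have mtheta i : index_range n i -> measurable_fun setT (theta i).
  by move=> ni; apply: measurable_funM; [exact: measurable_xi|exact: mQ'].
have thZ i : index_range n i -> (pnorm P p (theta i) <= Z)%E.
  by move=> ni; apply: HZ.
have mart : martingale_differences P F n theta.
  apply: martingale_differencesM => [| |i ni]; first exact: hxi.
  - exact: mQ.
  - apply: (pnorm_integrable p1 (mtheta _ ni)).
    by case/andP: Z0 => _; apply: le_lt_trans; exact: thZ.
have {}mart : martingale_differences P F (Some N) theta.
  by move=> i Ni; exact/mart/Nn.
rewrite (_ : Qfin xi N b = fun w => \sum_(1 <= i < N.+1) c i * theta i w); last first.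
  apply/funext => w; rewrite QfinS; apply: eq_bigr => i _.
  rewrite /theta /ci QfinZ [RHS]mulrCA; congr (_ * _).
  have [c0|c0] := eqVneq (c i) 0; last by rewrite mulrA mulfV// mul1r.
  by rewrite c0 mul0r Qfin_sqsum0// -cE c0 expr0n.
apply: (KM_le p1 hF mart) => //.
  (* The squares of the [c i] regroup, by last index, into the square sum of [b]. *)
  under eq_bigr do rewrite cE.
  by rewrite /sqsum /bi -(fsum_Iset_rcons N (fun I => b I ^+ 2)).
by move=> i /andP iN; apply: thZ; exact: Nn.
Qed.

Context (nu : nat -> R -> \bar R)
  (hnu : forall m p, nu m p = sup_pnorm P n (fun i => xi i m) p)
  (nu1 : forall m, (1 <= m <= d)%N -> (0 < nu m 1%R < +oo)%E).

Lemma pnorm_le_nu m p i : index_range n i -> (pnorm P p (xi i m) <= nu m p)%E.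
Proof.
by move=> ni; rewrite hnu; apply: ereal_sup_ubound; right; exists i.
Qed.

(** Moments increase with the exponent, so [nu m 1] is a lower bound on the whole half-line.
    Uniformity in [p] is what lets positivity survive the infimum in [otimes]. *)
Lemma nu_ge m : (1 <= m <= d)%N ->
  exists2 c : R, 0 < c & forall p, 1 <= p -> (c%:E <= nu m p)%E.
Proof.
move=> md; have /andP[nu0 nuoo] := nu1 md.
have nufin : nu m 1 \is a fin_num by rewrite ge0_fin_numE ?ltW.
exists (fine (nu m 1)); first by rewrite -lte_fin fineK.
move=> p p1; rewrite fineK// [leLHS]hnu.
apply: ge_ereal_sup => _ [->|[i ni <-]].
  by rewrite hnu; apply: ereal_sup_ubound; left.
apply: le_trans (le_pnorm1 _ p1 _) _; first exact: measurable_xi.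
exact: pnorm_le_nu.
Qed.

(** The uniform bounds multiply: [p / a] and [p / b] stay at least 1, and the factor [KM p] is at
    least 1. *)
Lemma zeta_ge m : (m < d)%N ->
  exists2 c : R, 0 < c & forall p, 1 <= p -> (c%:E <= zeta nu m.+1 p)%E.
Proof.
elim: m => [|m IH] md.
  have [c c0 cnu] := nu_ge (md : (1 <= 1 <= d)%N); exists c => // p p1 /=.
  rewrite -[c%:E]mul1e; apply: lee_pmul; rewrite ?lee_fin ?(ltW c0)//.
    by apply: KM_ge1; lra.
  exact: cnu.
have [c c0 cz] := IH (ltnW md).
have [c' c'0 cnu] := nu_ge (md : (1 <= m.+2 <= d)%N).
exists (c * c'); first exact: mulr_gt0.
move=> p p1; rewrite -[(c * c')%:E]mul1e.
apply: lee_pmul; rewrite ?lee_fin ?mulr_ge0 ?(ltW c0) ?(ltW c'0)//.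
  by apply: KM_ge1; lra.
apply: le_ereal_inf_tmp => _ [a [b [a0 b0 ab ->]]].
rewrite EFinM; apply: lee_pmul; rewrite ?lee_fin ?(ltW c0) ?(ltW c'0)//.
  by apply: cz; rewrite ler_pdivlMr// mul1r; lra.
by apply: cnu; rewrite ler_pdivlMr// mul1r; lra.
Qed.

(** The induction runs over all [p >= 1] at once, since Hölder's inequality calls for the lower
    degree at the larger exponent [p / a]. *)
Lemma pnorm_Qfin_le_zeta m (p : R) N (b : m.+1.-tuple nat -> R) : (m < d)%N ->
  1 <= p -> index_range (Some N) `<=` index_range n -> sqsum N b <= 1 ->
  (pnorm P p (Qfin xi N b) <= zeta nu m.+1 p)%E.
Proof.
elim: m p N b => [|m IH] p N b md p1 Nn b1.
  have [c c0 cnu] := nu_ge (md : (1 <= 1 <= d)%N).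
  apply: (@pnorm_Qfin_step 0) => //.
    by apply: lt_le_trans (cnu _ p1); rewrite lte_fin.
  (* In degree 0 the polynomial is the constant [b' [tuple]], of modulus at most 1. *)
  move=> i b' ni; rewrite /sqsum Iset0 fsbig_set1 => b'1.
  rewrite Qfin0; under eq_fun do rewrite mulrC.
  rewrite pnormZ; [|lra|exact: measurable_xi].
  apply: le_trans (lee_wpmul2r (pnorm_ge0 _ _ _) (_ : _ <= 1)%E) _.
    by rewrite lee_fin -(@ler_pXn2r _ 2) ?nnegrE// expr1n real_normK ?num_real.
  by rewrite mul1e; exact: pnorm_le_nu.
have [c c0 cz] := zeta_ge (ltnW md).
have [c' c'0 cnu] := nu_ge (md : (1 <= m.+2 <= d)%N).
have le_div (a : R) : 0 < a -> a <= 1 -> 1 <= p / a.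
  by move=> a0 a1; rewrite ler_pdivlMr// mul1r; lra.
apply: (@pnorm_Qfin_step m.+1) => //.
  rewrite (@lt_le_trans _ _ (c * c')%:E) ?lte_fin ?mulr_gt0//.
  apply: le_ereal_inf_tmp => _ [a [e [a0 e0 ae ->]]].
  rewrite EFinM; apply: lee_pmul; rewrite ?lee_fin ?(ltW c0) ?(ltW c'0)//.
    by apply/cz/le_div; lra.
  by apply/cnu/le_div; lra.
move=> i b' ni b'1.
have i1n : index_range (Some i.-1) `<=` index_range n by exact: index_range_pred.
(* The left-hand side is independent of the splitting, so it suffices to prove the bound for each
   pair [a], [e]. *)
apply: le_ereal_inf_tmp => _ [a [e [a0 e0 ae ->]]].
under eq_fun do rewrite mulrC.
apply: le_trans (pnorm_mul P _ a0 e0 ae _ _) _.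
- by lra.
- have [_ _ _ Fm] := hF; apply: measurable_wrt_measurable (Fm i.-1) _.
  by apply: measurable_wrt_Qfin => //; exact: ltnW.
- exact: measurable_xi.
apply: lee_pmul; rewrite ?pnorm_ge0//.
  by apply: IH => //; [exact: ltnW|apply: le_div; lra].
exact: pnorm_le_nu.
Qed.

End moment_bound.

(** * The two norms and the final comparison *)

Lemma sqsum_le1 (R : realType) (d : nat) (n : option nat) N
    (b : d.-tuple nat -> R) : Bset d n b ->
  index_range (Some N) `<=` index_range n -> sqsum N b <= 1.
Proof.
move=> b1 Nn; rewrite -lee_fin -b1 /sqsum -fsumEFin; last exact: finite_Iset.
apply: esum_ge; exists (Iset d (Some N)) => //; split; first exact: finite_Iset.
by move=> I [sI IN]; split=> // j; exact: Nn.
Qed.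

Lemma Gnorm_vec_ge1 (R : realType) (disp : measure_display)
    (T : measurableType disp) (P : probability T R) (n : option nat) (r : R)
    (nu : R -> \bar R) (xi : nat -> T -> R) :
  n <> Some 0%N -> 2 < r -> (forall p, nu p = sup_pnorm P n xi p) ->
  (forall p, 1 <= p -> p < r -> (0 < nu p < +oo)%E) ->
  (1 <= Gnorm_vec P n r nu xi)%E.
Proof.
(* One exponent inside the interval suffices, here the midpoint: the supremum over [i] of the
   moments divided by [nu p] is already 1 there. *)
move=> n0 r2 nuE nu0; pose p := (2 + r) / 2.
have [p2 pr] : 2 < p /\ p < r by split; rewrite /p; lra.
have /andP[nup_gt0 nup_lty] : (0 < nu p < +oo)%E by apply: nu0 => //; lra.
have nufin : nu p \is a fin_num by rewrite ge0_fin_numE ?ltW.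
have fnu0 : 0 < fine (nu p) by rewrite -lte_fin fineK.
apply: (@le_trans _ _
  (nnsup [set (pnorm P p (xi i) / nu p)%E | i in index_range n])); last first.
  by apply: ereal_sup_ubound; right; exists p => //; rewrite /= in_itv/= p2.
rewrite -(@lee_pmul2r _ (fine (nu p))%:E) ?fin_numE//.
rewrite mul1e fineK// [leLHS]nuE.
set s := nnsup _.
have s_ge0 : (0 <= s)%E by apply: ereal_sup_ubound; left.
apply: ge_ereal_sup => _ [->|[i ni <-]]; first by rewrite mule_ge0// ltW.
rewrite -[nu p]fineK// -lee_pdivrMr//.
apply: ereal_sup_ubound; right; exists i => //.
by rewrite -[in LHS](fineK nufin) inver gt_eqF.
Qed.

(** At [y = +oo] the quotient is 0 by convention, so infinite values of [zeta] are harmless. *)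
Lemma lee_divr1 (R : realType) (x y : \bar R) :
  (0 < y)%E -> (0 <= x)%E -> (x <= y)%E -> (x / y <= 1)%E.
Proof.
case: y => [y| |]//.
  rewrite lte_fin => y0 x0 xy.
  by rewrite inver gt_eqF// lee_pdivrMr// mul1e.
by rewrite invey mule0.
Qed.

Theorem theorem3p1 (R : realType) (disp : measure_display)
    (T : measurableType disp) (P : probability T R)
    (d : nat) (hd : (1 <= d)%N)
    (n : option nat) (hn : n <> Some 0%N)
    (F : nat -> set (set T)) (hF : is_filtration F)
    (xi : nat -> nat -> T -> R)
    (hxi : forall m, (1 <= m <= d)%N ->
       martingale_differences P F n (fun i => xi i m))
    (nu : nat -> R -> \bar R)
    (hnu : forall m p, nu m p = sup_pnorm P n (fun i => xi i m) p)
    (rr : nat -> R)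
    (hrr : forall m, (1 <= m <= d)%N -> 2 < rr m)
    (hG : forall m, (1 <= m <= d)%N -> Gclass (rr m) (nu m))
    (r : R) (hr : r = (\sum_(1 <= m < d.+1) (rr m)^-1)^-1)
    (hr1 : 1 < r) :
  (nnsup [set Gnorm P r (zeta nu d) (Qpoly xi n b)
        | b in [set b : d.-tuple nat -> R | Bset d n b /\ Qexists P xi n b]]
   <= \prod_(1 <= m < d.+1)
        Gnorm_vec P n (rr m) (nu m) (fun i => xi i m))%E.
Proof.
have nu_fin m p : (1 <= m <= d)%N -> 1 <= p -> p < rr m -> (0 < nu m p < +oo)%E.
  by move=> /hG[_ + _ _]; exact.
have prod_ge1 : (1 <= \prod_(1 <= m < d.+1)
    Gnorm_vec P n (rr m) (nu m) (fun i => xi i m))%E.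
  rewrite big_nat; elim/big_ind: _ => // [x y x1 y1|m /andP[m1 md]].
    by rewrite -[leLHS]mule1 lee_pmul.
  have md' : (1 <= m <= d)%N by rewrite m1.
  apply: Gnorm_vec_ge1 => //; [exact: hrr|by move=> p; apply: nu_fin].
apply: le_trans prod_ge1.
have nu1 m : (1 <= m <= d)%N -> (0 < nu m 1%R < +oo)%E.
  by move=> md; apply: nu_fin => //; have := hrr m md; lra.
(* Writing the degree as a successor matches the form in which the bounds on [zeta] are stated. *)
case: d => [//|d] in hd hxi hrr hG hr nu_fin nu1 *.
apply: ge_ereal_sup => _ [->//|[b [b1 bQ] <-]].
apply: ge_ereal_sup => x [->//|[p]]; rewrite /= in_itv/= => /andP[p2 _] <-.
have p1 : 1 <= p by lra.
have [c c0 cz] := zeta_ge hxi hnu nu1 (ltnSn d).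
apply: lee_divr1; [|exact: pnorm_ge0|].
  by apply: lt_le_trans (cz p p1); rewrite lte_fin.
have bound N : index_range (Some N) `<=` index_range n ->
    (pnorm P p (Qfin xi N b) <= zeta nu d.+1 p)%E.
  move=> Nn; apply: (pnorm_Qfin_le_zeta hF hxi hnu nu1) => //.
  exact: sqsum_le1 b1 Nn.
(* For finite [n] the bound is the claim itself; for [n = oo] it is uniform in [N] and passes to the
   almost sure limit. *)
case: n => [N|] in hn hxi hnu b1 bQ bound *; first exact: bound.
have [_ _ _ Fm] := hF.
have le_oo N : index_range (Some N) `<=` index_range None by move=> i [].
apply: (@pnorm_fatou _ _ _ P p (fun N => Qfin xi N b)) => [|N| |N].
- by lra.
- apply: measurable_wrt_measurable (Fm N) _.
  exact: (measurable_wrt_Qfin hF hxi).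
- by apply: filterS bQ => w.
- exact: bound.
Qed.
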